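(* Let $\mathcal{P}$ be a PTRS containing a rule $\ell\to\{p_1:C[\ell\sigma],\,p_2:s,\,\dots\}$, i.e., a rule whose right-hand side multi-distribution contains (as two of its entries) a term of the form $C[\ell\sigma]$ for some context $C$ and substitution $\sigma$, and a term $s$, such that there is a variable $x\in\mathcal{V}(\ell)$ with $x\in\mathcal{V}(x\sigma)\cap\mathcal{V}(s)$. Then $\mathtt{PAST}(\xrightarrow{\mathbf{f}}_{\mathcal{P}})$ holds if and only if $\mathtt{SAST}(\xrightarrow{\mathbf{f}}_{\mathcal{P}})$ holds.
   Context: Terms $\mathcal{T}$ over countable signature and variables; a context is a term with one hole. $\mathrm{FDist}(A)$: finite multisets of pairs $(p:a)$, $0<p\le1$, probabilities summing to 1. A PTRS is a countable set $\mathcal{P}$ of rules $\ell\to\mu$, $\ell$ non-variable, $\mu\in\mathrm{FDist}(\mathcal{T})$, variables of terms in $\mu$ among those of $\ell$. $t\xrightarrow{\mathbf{f}}_{\mathcal{P}}\{p_1:t_1,\dots,p_k:t_k\}$ iff $t|_\pi=\ell\sigma$, $t_j=t[r_j\sigma]_\pi$ for a position $\pi$, rule $\ell\to\{p_1:r_1,\dots,p_k:r_k\}$, substitution $\sigma$; normal forms admit no step. Lifting $\rightrightarrows$: smallest relation on multi-distributions with $\{1:t\}\rightrightarrows\{1:t\}$ for normal forms, $\{1:t\}\rightrightarrows\mu$ if $t\xrightarrow{\mathbf{f}}_{\mathcal{P}}\mu$, closed under $\bigcup_jp_j\cdot\mu_j\rightrightarrows\bigcup_jp_j\cdot\nu_j$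 ($\sum p_j=1$). $|\mu|$: probability of normal forms; $\mathrm{edl}((\mu_n))=\sum_n(1-|\mu_n|)$. $\mathtt{PAST}$: every infinite $\rightrightarrows$-sequence with $\mu_0=\{1:t\}$ has finite $\mathrm{edl}$. $\mathtt{SAST}$: for every term $t$, the supremum of $\mathrm{edl}$ over infinite $\rightrightarrows$-sequences with $\mu_0=\{1:t\}$ is finite. *)

(* Defs.v *)
From HB Require Import structures.
From mathcomp Require Import all_boot all_order all_algebra.
From mathcomp Require Import finmap multiset.
From mathcomp Require Import all_classical all_reals all_analysis.

Set Implicit Arguments.
Unset Strict Implicit.
Unset Printing Implicit Defensive.

Import Order.TTheory GRing.Theory Num.Theory.

Local Open Scope classical_set_scope.
Local Open Scope ring_scope.

Section Terms.
Context {F : countType} {ar : F -> nat} {V : countType}.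

Inductive term : Type :=
| Var of V
| App (f : F) of ('I_(ar f) -> term).

HB.instance Definition _ := gen_eqMixin term.
HB.instance Definition _ := gen_choiceMixin term.

Definition is_var (t : term) : Prop := exists x, t = Var x.

Fixpoint vars (t : term) : set V :=
  match t with
  | Var y => [set y]
  | App f args => \bigcup_i vars (args i)
  end.

Definition substitution := V -> term.

Fixpoint subst (sigma : substitution) (t : term) : term :=
  match t with
  | Var y => sigma y
  | App f args => App (fun i => subst sigma (args i))
  end.

(* Positions are sequences of argument indices, counted from 0. *)
Definition position := seq nat.

Fixpoint subterm_at (t : term) (pi : position) {struct pi} : option term :=
  match pi with
  | [::] => Some t
  | i :: pi' =>
      match t with
      | Var _ => None
      | App f args =>
          if @insub nat (fun k => k < ar f)%N 'I_(ar f) i is Some j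
          then subterm_at (args j) pi' else None
      end
  end.

(* Equals t itself when pi is not a position of t; it is only used under the
   assumption that subterm_at t pi is defined. *)
Fixpoint replace_at (t : term) (pi : position) (u : term) {struct pi} : term :=
  match pi with
  | [::] => u
  | i :: pi' =>
      match t with
      | Var _ => t
      | App f args =>
          App (fun j : 'I_(ar f) =>
                 if nat_of_ord j == i then replace_at (args j) pi' u
                 else args j)
      end
  end.

(* In CApp i args C, the i-th argument is the context C, and the other ones
   are given by args; the value args i is irrelevant. *)
Inductive context : Type :=
| Hole
| CApp (f : F) (i : 'I_(ar f)) (args : 'I_(ar f) -> term) of context.

Fixpoint fill (C : context) (u : term) : term :=
  match C with
  | Hole => u
  | CApp f i args C' =>
      App (fun j : 'I_(ar f) => if j == i then fill C' u else args j)
  end.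

End Terms.

Arguments term {F} ar V.
Arguments substitution {F} ar V.
Arguments context {F} ar V.

(* Finite multisets of pairs (p : a). A priori the weights are arbitrary;
   FDist(A) is cut out by is_fdist, and lifting_fdist with rewrite_step_fdist
   shows that the lifting only relates elements of FDist(A). *)
Notation multidist R A := {mset R * A}%mset.

Section MultiDistributions.
Context {R : realType} {A : choiceType}.

Definition is_fdist (mu : multidist R A) : Prop :=
  (forall e : R * A, e \in mu -> 0 < e.1 <= 1) /\ \sum_(e <- mu) e.1 = 1.

Definition dirac_fdist (a : A) : multidist R A := [mset (1, a)]%mset.

Definition scale_mset (p : R) (mu : multidist R A) : multidist R A :=
  seq_mset [seq (p * e.1, e.2) | e <- mu].

Definition convex_union (n : nat) (p : 'I_n -> R) (mu : 'I_n -> multidist R A) :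
    multidist R A :=
  \big[msetD/mset0]_(j < n) scale_mset (p j) (mu j).

Lemma is_fdist_dirac (a : A) : is_fdist (dirac_fdist a).
Proof.
split=> [e|]; last by rewrite enum_msetn big_seq1.
by rewrite in_mset1 => /eqP -> /=; rewrite ltr01 lexx.
Qed.

Lemma is_fdist_convex_union (n : nat) (p : 'I_n -> R) (mu : 'I_n -> multidist R A) :
  (forall j, 0 < p j <= 1) -> \sum_(j < n) p j = 1 ->
  (forall j, is_fdist (mu j)) -> is_fdist (convex_union p mu).
Proof.
move=> p01 p1 mufd; split.
- rewrite /convex_union; elim/big_ind: _ => [e|M N IM IN e|j _ e].
  + by rewrite in_mset0.
  + by rewrite in_msetD => /orP[/IM|/IN].
  + rewrite (perm_mem (perm_eq_seq_mset _)) => /mapP[e' /(proj1 (mufd j))].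
    move=> /andP[e0 e1] -> /=; have /andP[q0 q1] := p01 j.
    by rewrite mulr_gt0 //= mulr_ile1 // ltW.
- rewrite -p1 /convex_union.
  have sumD (M N : multidist R A) : \sum_(e <- (M `+` N)%mset) e.1 =
      \sum_(e <- M) e.1 + \sum_(e <- N) e.1.
    have h : perm_eq (M `+` N)%mset (M ++ N).
      by apply/allP => e _ /=; rewrite count_cat !count_mem_mset msetE2.
    by rewrite (perm_big _ h) big_cat.
  rewrite (big_morph (fun M : multidist R A => \sum_(e <- M) e.1) sumD (id1 := 0));
    last by rewrite enum_mset0 big_nil.
  apply: eq_bigr => j _; rewrite (perm_big _ (perm_eq_seq_mset _)) big_map.
  by rewrite -mulr_sumr (proj2 (mufd j)) mulr1.
Qed.

End MultiDistributions.

Definition map_fdist (R : realType) (A B : choiceType) (g : A -> B)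
    (mu : multidist R A) : multidist R B :=
  seq_mset [seq (e.1, g e.2) | e <- mu].

Section Lifting.
Context {R : realType} {A : choiceType}.
Variable step : A -> multidist R A -> Prop.

Definition normal_form (a : A) : Prop := ~ exists mu, step a mu.

Inductive lifting : multidist R A -> multidist R A -> Prop :=
| lifting_nf a : normal_form a -> lifting (dirac_fdist a) (dirac_fdist a)
| lifting_step a mu : step a mu -> lifting (dirac_fdist a) mu
| lifting_union n (p : 'I_n -> R) (mu nu : 'I_n -> multidist R A) :
    (forall j, 0 < p j <= 1) -> \sum_(j < n) p j = 1 ->
    (forall j, lifting (mu j) (nu j)) ->
    lifting (convex_union p mu) (convex_union p nu).

Lemma lifting_fdist mu nu :
  (forall a rho, step a rho -> is_fdist rho) ->
  lifting mu nu -> is_fdist mu /\ is_fdist nu.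
Proof.
move=> stepP; elim=> {mu nu} [a _|a mu /stepP fmu|n p mu nu p01 p1 _ IH].
- by split; apply: is_fdist_dirac.
- by split; first exact: is_fdist_dirac.
- by split; apply: is_fdist_convex_union => // j; have [] := IH j.
Qed.

Definition nf_prob (mu : multidist R A) : R :=
  \sum_(e <- mu | `[< normal_form e.2 >]) e.1.

Definition edl (mu : nat -> multidist R A) : \bar R :=
  (\sum_(0 <= n <oo) (1 - nf_prob (mu n))%:E)%E.

Definition lifting_seqs (a : A) : set (nat -> multidist R A) :=
  [set mu | mu 0%N = dirac_fdist a /\ forall n, lifting (mu n) (mu n.+1)].

Definition PAST : Prop :=
  forall (a : A) mu, lifting_seqs a mu -> (edl mu < +oo)%E.

Definition SAST : Prop :=
  forall a : A, (ereal_sup [set edl mu | mu in lifting_seqs a] < +oo)%E.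

End Lifting.

Section PTRS.
Context {R : realType} {F : countType} {ar : F -> nat} {V : countType}.
Local Notation T := (term ar V).

Definition is_ptrs (P : set (T * multidist R T)) : Prop :=
  countable P /\
  forall l mu, P (l, mu) ->
    [/\ ~ is_var l, is_fdist mu &
        forall e, e \in mu -> vars e.2 `<=` vars l].

Definition rewrite_step (P : set (T * multidist R T)) (t : T)
    (nu : multidist R T) : Prop :=
  exists (pi : position) l mu (sigma : substitution ar V),
    [/\ P (l, mu), subterm_at t pi = Some (subst sigma l) &
        nu = map_fdist (fun r => replace_at t pi (subst sigma r)) mu].

Lemma rewrite_step_fdist (P : set (T * multidist R T)) t nu :
  is_ptrs P -> rewrite_step P t nu -> is_fdist nu.
Proof.
move=> [_ PP] [pi [l [mu [sigma [/PP[_ [mu01 mu1] _] _ ->]]]]]; split=> [e|].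
  by rewrite (perm_mem (perm_eq_seq_mset _)) => /mapP[e' /mu01 ? ->].
by rewrite (perm_big _ (perm_eq_seq_mset _)) big_map.
Qed.

End PTRS.

(* Main.v *)
(** If [SAST] fails at a term [t], then the expected derivation lengths of the
    runs from [t] are unbounded.  Instantiate all variables of the looping rule
    by [t].  The loop branch is taken [k] times in a row with probability
    [p1 ^+ k], and the remaining branches then include [s], under a context and
    with [t] as a subterm, because [x] survives in both [sigma x] and [s].  So
    when the loop is left at stage [k], one may continue with a run whose
    expected derivation length is so large that it contributes at least [1] to
    the total.  Doing so for every [k] gives an infinite expected derivation
    length, and [PAST] fails.

    A run from [t] does not lift to a run from a context around [t], since
    normal forms may become reducible there.  The supremum of the expected
    derivation lengths is therefore computed from the optimal values at finite
    horizons, which satisfy a recursive equation and are visibly monotone under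
    any map that preserves rewrite steps. *)

Require Import Defs.
From mathcomp Require Import all_boot all_order all_algebra.
From mathcomp Require Import finmap multiset.
From mathcomp Require Import all_classical all_reals all_analysis.
From mathcomp Require Import lra.

Set Implicit Arguments.
Unset Strict Implicit.
Unset Printing Implicit Defensive.

Import Order.TTheory GRing.Theory Num.Theory.

Local Open Scope classical_set_scope.
Local Open Scope ring_scope.

Section MultisetImage.
Context {I J : choiceType}.

Lemma perm_enum_msetD (M N : {mset I}%mset) : perm_eq (M `+` N)%mset (M ++ N).
Proof. by apply/allP => e _ /=; rewrite count_cat !count_mem_mset msetE2. Qed.

Lemma seq_mset_mapD (f : I -> J) (M N : {mset I}%mset) :
  seq_mset [seq f e | e <- (M `+` N)%mset] =
  (seq_mset [seq f e | e <- M] `+` seq_mset [seq f e | e <- N])%mset.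
Proof.
apply/msetP => e; rewrite msetE2 !mset_seqE -count_cat -map_cat.
exact/permP/perm_map/perm_enum_msetD.
Qed.

Lemma seq_mset_map_seq_mset (f : I -> J) (s : seq I) :
  seq_mset [seq f e | e <- seq_mset s] = seq_mset [seq f e | e <- s].
Proof. exact/eq_seq_msetP/perm_map/perm_eq_seq_mset. Qed.

Lemma big_msetD_mset1 (s : seq I) :
  \big[msetD/mset0]_(e <- s) [mset e]%mset = seq_mset s.
Proof.
elim: s => [|e s IH]; last by rewrite big_cons mset_cons IH.
by rewrite big_nil -[LHS]seq_mset_id enum_mset0.
Qed.

End MultisetImage.

Section Expectation.
Context {R : realType} {A : choiceType}.
Implicit Types (f g : A -> R) (mu nu : multidist R A).

Definition expect f mu : R := \sum_(e <- mu) e.1 * f e.2.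

Lemma expect1 mu : expect (fun=> 1) mu = \sum_(e <- mu) e.1.
Proof. by apply: eq_bigr => e _; rewrite mulr1. Qed.

Lemma expect_mset1 f e : expect f [mset e]%mset = e.1 * f e.2.
Proof. by rewrite /expect enum_msetn big_seq1. Qed.

Lemma expect_dirac f a : expect f (dirac_fdist a) = f a.
Proof. by rewrite expect_mset1 mul1r. Qed.

Lemma expect_msetD f mu nu :
  expect f (mu `+` nu)%mset = expect f mu + expect f nu.
Proof. by rewrite /expect (perm_big _ (perm_enum_msetD _ _)) big_cat. Qed.

Lemma expectD f g mu :
  expect (fun a => f a + g a) mu = expect f mu + expect g mu.
Proof.
by rewrite /expect -big_split; apply: eq_bigr => e _; rewrite mulrDr.
Qed.

Lemma expect_scale_mset f p mu : expect f (scale_mset p mu) = p * expect f mu.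
Proof.
rewrite /expect (perm_big _ (perm_eq_seq_mset _)) big_map mulr_sumr.
by apply: eq_bigr => e _; rewrite mulrA.
Qed.

Lemma expect_convex_union f n (p : 'I_n -> R) (mu : 'I_n -> multidist R A) :
  expect f (convex_union p mu) = \sum_(j < n) p j * expect f (mu j).
Proof.
rewrite /convex_union (big_morph _ (expect_msetD f) (id1 := 0)).
  by apply: eq_bigr => j _; exact: expect_scale_mset.
by rewrite /expect big_mset0.
Qed.

Lemma expect_cst c mu : is_fdist mu -> expect (fun=> c) mu = c.
Proof. by move=> [_ mu1]; rewrite /expect -mulr_suml mu1 mul1r. Qed.

Lemma le_expect f g mu :
  is_fdist mu -> (forall a, f a <= g a) -> expect f mu <= expect g mu.
Proof.
move=> [mu01 _] fg; rewrite /expect big_seq [leRHS]big_seq.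
by apply: ler_sum => e /mu01 /andP[e0 _]; rewrite ler_pM2l.
Qed.

Lemma expect_bounds f c d mu : is_fdist mu -> (forall a, c <= f a <= d) ->
  c <= expect f mu <= d.
Proof.
move=> fmu fcd; rewrite -{1}(expect_cst c fmu) -(expect_cst d fmu).
by apply/andP; split; apply: le_expect => // a; case/andP: (fcd a).
Qed.

Lemma expect_ge_weight f mu e : (forall e', e' \in mu -> 0 < e'.1) ->
  (forall a, 0 <= f a) -> e \in mu -> e.1 * f e.2 <= expect f mu.
Proof.
move=> mu0 f0 emu; rewrite /expect (big_rem _ emu) /= lerDl big_seq.
apply: sumr_ge0 => e' /mem_rem /mu0 e'0.
by rewrite mulr_ge0 // ltW.
Qed.

Lemma is_fdist_pos mu : (forall e, e \in mu -> 0 < e.1) ->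
  \sum_(e <- mu) e.1 = 1 -> is_fdist mu.
Proof.
move=> mu0 mu1; split=> // e emu; rewrite mu0 //= -mu1.
by have := expect_ge_weight mu0 (fun=> ler01) emu; rewrite expect1 mulr1.
Qed.

End Expectation.

Section Scale.
Context {R : realType} {A : choiceType}.
Implicit Types (p q : R) (mu : multidist R A).

Lemma scale_mset1 mu : scale_mset 1 mu = mu.
Proof.
rewrite -[RHS]seq_mset_id; congr seq_mset.
by rewrite -[RHS]map_id; apply: eq_map => -[q a] /=; rewrite mul1r.
Qed.

Lemma scale_mset_comp p q mu :
  scale_mset p (scale_mset q mu) = scale_mset (p * q) mu.
Proof.
rewrite /scale_mset seq_mset_map_seq_mset -map_comp.
by under eq_map do rewrite /= mulrA.
Qed.

Lemma scale_dirac p a :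
  scale_mset p (dirac_fdist a) = [mset (p, a)]%mset :> multidist R A.
Proof. by rewrite -[RHS]seq_mset_id /scale_mset !enum_msetn /= mulr1. Qed.

End Scale.

Section Bind.
Context {R : realType} {A : choiceType}.
Implicit Types mu : multidist R A.

Definition bind_fdist (B : choiceType) mu (f : A -> multidist R B) :
    multidist R B :=
  convex_union (fun i => (tnth (in_tuple mu) i).1)
    (fun i => f (tnth (in_tuple mu) i).2).

Lemma expect_bind_fdist (B : choiceType) (g : B -> R) mu
    (f : A -> multidist R B) :
  expect g (bind_fdist mu f) = expect (fun a => expect g (f a)) mu.
Proof. by rewrite expect_convex_union /expect [RHS]big_tnth. Qed.

Lemma bind_fdist_dirac mu : bind_fdist mu (@dirac_fdist R A) = mu.
Proof.
rewrite /bind_fdist /convex_union.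
under eq_bigr do rewrite scale_dirac -surjective_pairing.
rewrite -(big_tnth _ _ mu predT (fun e : R * A => [mset e]%mset)).
by rewrite big_msetD_mset1 seq_mset_id.
Qed.

End Bind.

Section Mix.
Context {R : realType} {A : choiceType}.
Implicit Types (p : R) (mu nu : multidist R A).

Definition mix_fdist p mu nu : multidist R A :=
  (scale_mset p mu `+` scale_mset (1 - p) nu)%mset.

Lemma expect_mix_fdist f p mu nu :
  expect f (mix_fdist p mu nu) = p * expect f mu + (1 - p) * expect f nu.
Proof. by rewrite expect_msetD !expect_scale_mset. Qed.

Lemma mix_fdistE p mu nu : mix_fdist p mu nu =
  convex_union (fun i : 'I_2 => if i == ord0 then p else 1 - p)
    (fun i => if i == ord0 then mu else nu).
Proof. by rewrite /convex_union !big_ord_recl big_ord0 msetD0. Qed.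

(* [mu] conditioned on the entries other than one copy of [e]; meaningful only
   for [e.1 < 1]. *)
Definition rem_fdist mu (e : R * A) : multidist R A :=
  scale_mset (1 - e.1)^-1 (mu `\ e)%mset.

Lemma mem_rem_fdist mu e q b :
  (q, b) \in (mu `\ e)%mset -> (q / (1 - e.1), b) \in rem_fdist mu e.
Proof.
move=> qb; rewrite (perm_mem (perm_eq_seq_mset _)).
by apply/mapP; exists (q, b) => //=; rewrite mulrC.
Qed.

Lemma mix_rem_fdist mu e : e \in mu -> e.1 < 1 ->
  mu = mix_fdist e.1 (dirac_fdist e.2) (rem_fdist mu e).
Proof.
move=> emu e_lt1; rewrite /mix_fdist /rem_fdist scale_mset_comp mulfV.
  by rewrite scale_mset1 scale_dirac -surjective_pairing msetB1K.
by rewrite subr_eq0 gt_eqF.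
Qed.

Lemma fdist_weight_lt1 mu e d :
  is_fdist mu -> e \in mu -> d \in (mu `\ e)%mset -> e.1 < 1.
Proof.
move=> fmu emu drem.
have rem_pos d' : d' \in (mu `\ e)%mset -> 0 < d'.1.
  by move=> /(msubset_subset (msubD1set mu e))/fmu.1/andP[].
have := expect_ge_weight rem_pos (fun=> ler01) drem; have := rem_pos _ drem.
have := expect_cst 1 fmu; rewrite -{1}(msetB1K emu) expect_msetD expect_mset1.
by rewrite !mulr1; lra.
Qed.

Lemma is_fdist_rem mu e : is_fdist mu -> e \in mu -> e.1 < 1 ->
  is_fdist (rem_fdist mu e).
Proof.
move=> fmu emu e_lt1; have rest_gt0 : 0 < 1 - e.1 by rewrite subr_gt0.
apply: is_fdist_pos => [e'|].
  rewrite (perm_mem (perm_eq_seq_mset _)) => /mapP[d dmu ->] /=.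
  rewrite mulr_gt0 ?invr_gt0 //.
  by case/andP: (fmu.1 d (msubset_subset (msubD1set mu e) dmu)).
have := expect_cst 1 fmu; rewrite {1}(mix_rem_fdist emu e_lt1).
rewrite expect_mix_fdist expect_dirac expect1 mulr1 => sum1.
apply: (mulfI (lt0r_neq0 rest_gt0)); rewrite mulr1.
by apply: (addrI e.1); rewrite sum1 subrKC.
Qed.

End Mix.

Section MapFdist.
Context {R : realType}.

Lemma expect_map_fdist (A B : choiceType) (f : B -> R) (g : A -> B)
  (mu : multidist R A) : expect f (map_fdist g mu) = expect (f \o g) mu.
Proof. by rewrite /expect (perm_big _ (perm_eq_seq_mset _)) big_map. Qed.

Lemma map_fdist_id (A : choiceType) (mu : multidist R A) : map_fdist id mu = mu.
Proof.
rewrite -[RHS]seq_mset_id; congr seq_mset.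
by rewrite -[RHS]map_id; apply: eq_map => -[].
Qed.

Lemma map_fdist_comp (A B C : choiceType) (g : B -> C) (h : A -> B)
    (mu : multidist R A) :
  map_fdist (g \o h) mu = map_fdist g (map_fdist h mu).
Proof. by rewrite /map_fdist seq_mset_map_seq_mset -map_comp. Qed.

Lemma map_fdist_dirac (A B : choiceType) (g : A -> B) a :
  map_fdist g (dirac_fdist a) = dirac_fdist (g a) :> multidist R B.
Proof. by rewrite -[RHS]seq_mset_id /map_fdist !enum_msetn. Qed.

Lemma is_fdist_map (A B : choiceType) (g : A -> B) (mu : multidist R A) :
  is_fdist mu -> is_fdist (map_fdist g mu).
Proof.
move=> [mu01 mu1]; split=> [e|].
  by rewrite (perm_mem (perm_eq_seq_mset _)) => /mapP[e' /mu01 ? ->].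
by rewrite (perm_big _ (perm_eq_seq_mset _)) big_map.
Qed.

Lemma mem_map_fdist (A B : choiceType) (g : A -> B) (mu : multidist R A) q a :
  (q, a) \in mu -> (q, g a) \in map_fdist g mu.
Proof.
move=> amu; rewrite (perm_mem (perm_eq_seq_mset _)).
by apply/mapP; exists (q, a).
Qed.

Lemma map_fdist_scale (A B : choiceType) (g : A -> B) p (mu : multidist R A) :
  map_fdist g (scale_mset p mu) = scale_mset p (map_fdist g mu).
Proof.
by rewrite /map_fdist /scale_mset !seq_mset_map_seq_mset -!map_comp.
Qed.

Lemma map_fdist_mix (A B : choiceType) (g : A -> B) p (mu nu : multidist R A) :
  map_fdist g (mix_fdist p mu nu) =
  mix_fdist p (map_fdist g mu) (map_fdist g nu).
Proof. by rewrite /mix_fdist -!map_fdist_scale; exact: seq_mset_mapD. Qed.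

End MapFdist.

Section Lifting.
Context {R : realType} {A : choiceType} (step : A -> multidist R A -> Prop).
Implicit Types (mu nu : multidist R A).

Lemma lifting_mix_fdist p mu mu' nu nu' : 0 < p < 1 ->
  lifting step mu mu' -> lifting step nu nu' ->
  lifting step (mix_fdist p mu nu) (mix_fdist p mu' nu').
Proof.
move=> /andP[p0 p1] mumu' nunu'; rewrite !mix_fdistE; apply: lifting_union.
- by move=> i; case: eqP => _; apply/andP; split; lra.
- by rewrite !big_ord_recl big_ord0 /= addr0 subrKC.
- by move=> i; case: eqP.
Qed.

Lemma lifting_bind_fdist mu f : is_fdist mu ->
  (forall a, lifting step (dirac_fdist a) (f a)) ->
  lifting step mu (bind_fdist mu f).
Proof.
move=> [mu01 mu1] step_f; rewrite -{1}(bind_fdist_dirac mu).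
apply: lifting_union.
- by move=> i; exact: mu01 (mem_tnth _ (in_tuple mu)).
- by rewrite -(big_tnth _ _ mu predT (fun e : R * A => e.1)).
- by move=> i; exact: step_f.
Qed.

Lemma lifting_total mu : is_fdist mu -> exists nu, lifting step mu nu.
Proof.
have /choice[f step_f] a : exists nu, lifting step (dirac_fdist a) nu.
  case: (pselect (normal_form step a)) => [nfa|/contrapT[nu anu]].
    by exists (dirac_fdist a); exact: lifting_nf.
  by exists nu; exact: lifting_step.
by exists (bind_fdist mu f); exact: lifting_bind_fdist.
Qed.

End Lifting.

Section Runs.
Context {R : realType} {A : choiceType} (step : A -> multidist R A -> Prop).
Hypothesis step_fdist : forall a nu, step a nu -> is_fdist nu.
Implicit Types (a : A) (mu nu : multidist R A) (S T : nat -> multidist R A).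

Definition runs mu : set (nat -> multidist R A) :=
  [set S | S 0%N = mu /\ forall n, lifting step (S n) (S n.+1)].

Definition sup_edl mu : \bar R := ereal_sup [set edl step S | S in runs mu].

Definition run_cons mu S (n : nat) : multidist R A :=
  if n is n'.+1 then S n' else mu.

Definition reducible a : R := (`[< ~ normal_form step a >])%:R.

Lemma reducible_bounds a : 0 <= reducible a <= 1.
Proof. by rewrite /reducible ler0n lern1 leq_b1. Qed.

Lemma reducible_nf a : normal_form step a -> reducible a = 0.
Proof. by move=> nfa; rewrite /reducible asboolF. Qed.

Lemma reducible_step a nu : step a nu -> reducible a = 1.
Proof.
by move=> anu; rewrite /reducible asboolT //; apply; exists nu.
Qed.

Lemma expect_reducible_ge0 mu : is_fdist mu -> 0 <= expect reducible mu.
Proof. by move=> /expect_bounds /(_ reducible_bounds) /andP[]. Qed.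

Lemma nf_probE mu : is_fdist mu -> nf_prob step mu = 1 - expect reducible mu.
Proof.
move=> [_ mu1]; rewrite /nf_prob /expect -mu1 -sumrB big_mkcond /=.
apply: eq_bigr => e _; rewrite /reducible asbool_neg.
by case: asbool; rewrite /= ?mulr0 ?mulr1 ?subr0 ?subrr.
Qed.

Lemma runs_fdist mu S n : runs mu S -> is_fdist (S n).
Proof. by move=> [_ /(_ n)] /(lifting_fdist step_fdist)[]. Qed.

Lemma runs_behead mu S : runs mu S -> runs (S 1%N) (fun n => S n.+1).
Proof. by move=> [_ liftS]; split=> // n; exact: liftS. Qed.

Lemma runs_cons mu nu S :
  lifting step mu nu -> runs nu S -> runs mu (run_cons mu S).
Proof. by move=> munu [S0 liftS]; split=> // -[|n] //=; rewrite S0. Qed.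

Lemma runs_mix_fdist p mu nu S T : 0 < p < 1 -> runs mu S -> runs nu T ->
  runs (mix_fdist p mu nu) (fun n => mix_fdist p (S n) (T n)).
Proof.
move=> p01 [S0 liftS] [T0 liftT]; split; first by rewrite S0 T0.
by move=> n; exact: lifting_mix_fdist.
Qed.

Lemma runs_nonempty mu : is_fdist mu -> runs mu !=set0.
Proof.
move=> fmu.
pose next nu nu' := is_fdist nu -> lifting step nu nu'.
have next_total nu : {nu' | next nu nu'}.
  have [/(lifting_total step)/cid[nu' ?]|nfnu] := pselect (is_fdist nu).
    by exists nu'.
  by exists nu.
have [S [S0 nextS]] := dependent_choice next_total mu.
exists S; split=> // n; apply/nextS.
elim: n => [|n /nextS /(lifting_fdist step_fdist) []] //.
by rewrite S0.
Qed.

Lemma edlE mu S : runs mu S ->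
  edl step S = (\sum_(0 <= n <oo) (expect reducible (S n))%:E)%E.
Proof.
move=> runS; apply: eq_eseriesr => n _.
by rewrite nf_probE ?subKr //; exact: runs_fdist runS.
Qed.

Lemma runs_reducible_ge0 mu S n : runs mu S ->
  (0 <= (expect reducible (S n))%:E)%E.
Proof.
by move=> /runs_fdist fS; rewrite lee_fin expect_reducible_ge0.
Qed.

Lemma edl_ge0 mu S : runs mu S -> (0 <= edl step S)%E.
Proof.
by move=> runS; rewrite (edlE runS) nneseries_ge0 // => n _ _;
  exact: runs_reducible_ge0 runS.
Qed.

Lemma edl_behead mu S : runs mu S ->
  edl step S = ((expect reducible mu)%:E + edl step (fun n => S n.+1))%E.
Proof.
move=> runS; have S_ge0 n := runs_reducible_ge0 n runS.
rewrite (edlE runS) (edlE (runs_behead runS)) nneseries_recl // runS.1.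
rewrite -(nneseries_addn (f := fun n => (expect reducible (S n))%:E) 1) //.
by under eq_eseriesr do rewrite addn1.
Qed.

Lemma edl_mix_fdist p mu nu S T : 0 < p < 1 -> runs mu S -> runs nu T ->
  edl step (fun n => mix_fdist p (S n) (T n)) =
  (p%:E * edl step S + (1 - p)%:E * edl step T)%E.
Proof.
move=> p01 runS runT; have /andP[p0 p1] := p01.
have S_ge0 n := runs_reducible_ge0 n runS.
have T_ge0 n := runs_reducible_ge0 n runT.
rewrite (edlE (runs_mix_fdist p01 runS runT)) (edlE runS) (edlE runT).
rewrite -!nneseriesZl // -nneseriesD => [|n _ _|n _ _]; first last.
- by rewrite mule_ge0 // lee_fin subr_ge0 ltW.
- by rewrite mule_ge0 // lee_fin ltW.
by apply: eq_eseriesr => n _; rewrite expect_mix_fdist EFinD !EFinM.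
Qed.

Lemma edl_le_sup mu S : runs mu S -> (edl step S <= sup_edl mu)%E.
Proof. by move=> runS; apply: ereal_sup_ubound; exists S. Qed.

Lemma sup_edl_lifting mu nu : lifting step mu nu ->
  ((expect reducible mu)%:E + sup_edl nu <= sup_edl mu)%E.
Proof.
move=> munu; rewrite -leeBrDl //; apply: ge_ereal_sup => _ [S runS <-].
have run_muS := runs_cons munu runS; rewrite leeBrDl //.
by apply: le_trans (edl_le_sup run_muS); rewrite (edl_behead run_muS).
Qed.

Lemma SAST_PAST : SAST step -> PAST step.
Proof. by move=> sast a S /edl_le_sup /le_lt_trans; apply; exact: sast. Qed.

End Runs.

Section Value.
Context {R : realType} {A : choiceType} (step : A -> multidist R A -> Prop).
Hypothesis step_fdist : forall a nu, step a nu -> is_fdist nu.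
Implicit Types (a : A) (mu nu : multidist R A) (S : nat -> multidist R A).
Local Notation reducible := (reducible step).

(* The optimal expected number of steps within horizon [N]; at normal forms the
   supremum is over the empty set, hence [0]. *)
Fixpoint value N a : R :=
  if N is N'.+1 then sup [set 1 + expect (value N') nu | nu in step a] else 0.

Lemma value_nf N a : normal_form step a -> value N a = 0.
Proof.
case: N => //= N nfa; rewrite (_ : [set _ | _ in _] = set0) ?sup0 //.
by apply/seteqP; split=> // y [nu anu _]; apply: nfa; exists nu.
Qed.

Lemma value_bounds N a : 0 <= value N a <= N%:R.
Proof.
elim: N a => [|N IH] a; first by rewrite /= lexx.
have [nfa|/contrapT[nu anu]] := pselect (normal_form step a).
  by rewrite value_nf // lexx ler0n.
have step_bounds rho : step a rho -> 0 <= 1 + expect (value N) rho <= N.+1%:R.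
  move=> /step_fdist/expect_bounds/(_ IH)/andP[ge0 leN].
  by rewrite addr_ge0 //= -natr1 addrC lerD2r.
apply/andP; split.
- apply: le_trans (ub_le_sup _ (imageP _ anu)).
    by case/andP: (step_bounds _ anu).
  by exists N.+1%:R => _ [rho /step_bounds/andP[_ leN] <-].
- apply: ge_sup; first by exists (1 + expect (value N) nu), nu.
  by move=> _ [rho /step_bounds/andP[_ leN] <-].
Qed.

Lemma value_ge0 N a : 0 <= value N a.
Proof. by case/andP: (value_bounds N a). Qed.

Lemma has_sup_value N a nu : step a nu ->
  has_sup [set 1 + expect (value N) nu | nu in step a].
Proof.
move=> anu; split; first by exists (1 + expect (value N) nu), nu.
exists (1 + N%:R) => _ [rho /step_fdist frho <-]; rewrite lerD2l.
by case/andP: (expect_bounds frho (value_bounds N)).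
Qed.

Lemma value_step N a nu : step a nu -> 1 + expect (value N) nu <= value N.+1 a.
Proof.
by move=> anu; apply: sup_upper_bound; [exact: has_sup_value anu|exists nu].
Qed.

Lemma value_lifting N mu nu : lifting step mu nu ->
  expect reducible mu + expect (value N) nu <= expect (value N.+1) mu.
Proof.
elim=> {mu nu} [a nfa|a nu anu|n p mu nu p01 p1 _ IH].
- by rewrite !expect_dirac reducible_nf // !value_nf // addr0.
- by rewrite !expect_dirac (reducible_step anu) value_step.
- rewrite !expect_convex_union -big_split /=; apply: ler_sum => j _.
  by rewrite -mulrDr ler_wpM2l //; case/andP: (p01 j) => /ltW.
Qed.

Lemma sum_reducible_le_value N mu S : runs step mu S ->
  \sum_(n < N) expect reducible (S n) <= expect (value N) mu.
Proof.
elim: N mu S => [|N IH] mu S runS.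
  by rewrite big_ord0 /expect big1 // => e _; rewrite mulr0.
rewrite big_ord_recl -runS.1.
apply: le_trans (value_lifting N (runS.2 0%N)).
by rewrite lerD2l; exact: IH (runs_behead runS).
Qed.

Lemma near_optimal_lifting N mu eps : is_fdist mu -> 0 < eps ->
  exists2 nu, lifting step mu nu &
    expect (value N.+1) mu <= expect reducible mu + expect (value N) nu + eps.
Proof.
move=> fmu eps0.
have /choice[f f_opt] a : exists nu, lifting step (dirac_fdist a) nu /\
    value N.+1 a <= reducible a + expect (value N) nu + eps.
  have [nfa|/contrapT[nu0 anu0]] := pselect (normal_form step a).
    exists (dirac_fdist a); split; first exact: lifting_nf.
    by rewrite expect_dirac reducible_nf // !value_nf // !add0r ltW.
  have [_ [nu anu <-] near_sup] := sup_adherent eps0 (has_sup_value N anu0).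
  exists nu; split; first exact: lifting_step.
  by rewrite (reducible_step anu) -lerBlDr ltW.
exists (bind_fdist mu f).
  by apply: lifting_bind_fdist => // a; case: (f_opt a).
rewrite expect_bind_fdist -expectD -(expect_cst eps fmu) -expectD.
by apply: le_expect => // a; case: (f_opt a).
Qed.

Lemma expect_value_le_sup_edl N mu : is_fdist mu ->
  ((expect (value N) mu)%:E <= sup_edl step mu)%E.
Proof.
elim: N mu => [|N IH] mu fmu.
  have [S runS] := runs_nonempty step_fdist fmu.
  rewrite [X in X%:E](expect_cst 0 fmu).
  exact: le_trans (edl_ge0 step_fdist runS) (edl_le_sup runS).
apply/lee_addgt0Pr => eps eps0.
have [nu munu near_opt] := near_optimal_lifting N fmu eps0.
have [_ fnu] := lifting_fdist step_fdist munu.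
apply: (@le_trans _ _ ((expect reducible mu + expect (value N) nu + eps)%:E)).
  by rewrite lee_fin.
rewrite !EFinD leeD2r //; apply: le_trans (sup_edl_lifting step_fdist munu).
by rewrite leeD2l // IH.
Qed.

Lemma sup_edl_value mu : is_fdist mu ->
  sup_edl step mu = ereal_sup (range (fun N => (expect (value N) mu)%:E)).
Proof.
move=> fmu; apply/eqP; rewrite eq_le; apply/andP; split; last first.
  by apply: ge_ereal_sup => _ [N _ <-]; exact: expect_value_le_sup_edl.
apply: ge_ereal_sup => _ [S runS <-]; rewrite (edlE step_fdist runS).
apply: lime_le.
  by apply: is_cvg_nneseries => n _ _; exact: runs_reducible_ge0 runS.
apply: nearW => N; rewrite big_mkord sumEFin.
apply: (@le_trans _ _ (expect (value N) mu)%:E).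
  by rewrite lee_fin sum_reducible_le_value.
by apply: ereal_sup_ubound; exists N.
Qed.

Lemma sup_edl_ge_mem mu e : is_fdist mu -> e \in mu ->
  (e.1%:E * sup_edl step (dirac_fdist e.2) <= sup_edl step mu)%E.
Proof.
move=> fmu emu; have mu0 e' : e' \in mu -> 0 < e'.1 by move=> /fmu.1/andP[].
rewrite (sup_edl_value (is_fdist_dirac _)) -ereal_sup_pZl ?mu0 //.
apply: ge_ereal_sup => _ [_ [N _ <-] <-].
apply: le_trans (expect_value_le_sup_edl N fmu).
rewrite expect_dirac -EFinM lee_fin.
by apply: expect_ge_weight => // a; exact: value_ge0.
Qed.

Lemma sup_edl_mem_infty mu q b : is_fdist mu -> (q, b) \in mu ->
  sup_edl step (dirac_fdist b) = +oo%E -> sup_edl step mu = +oo%E.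
Proof.
move=> fmu bmu b_infty; apply/eqP; rewrite -leye_eq.
have /andP[q0 _] := fmu.1 _ bmu.
by have := sup_edl_ge_mem fmu bmu; rewrite b_infty gt0_muley.
Qed.

End Value.

Section Simulation.
Context {R : realType}.

Definition simulation (A B : choiceType) (stepA : A -> multidist R A -> Prop)
    (stepB : B -> multidist R B -> Prop) (g : A -> B) : Prop :=
  forall a mu, stepA a mu -> stepB (g a) (map_fdist g mu).

Lemma simulation_id (A : choiceType) (step : A -> multidist R A -> Prop) :
  simulation step step id.
Proof. by move=> a mu; rewrite map_fdist_id. Qed.

Lemma simulation_comp (A B C : choiceType) (stepA : A -> multidist R A -> Prop)
    (stepB : B -> multidist R B -> Prop) (stepC : C -> multidist R C -> Prop)
    g h :
  simulation stepB stepC g -> simulation stepA stepB h ->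
  simulation stepA stepC (g \o h).
Proof. by move=> sim_g sim_h a mu /sim_h/sim_g; rewrite -map_fdist_comp. Qed.

Lemma simulation_iter (A : choiceType) (step : A -> multidist R A -> Prop) h k :
  simulation step step h -> simulation step step (iter k h).
Proof.
move=> sim_h; elim: k => [|k IH]; first exact: simulation_id.
exact: (simulation_comp sim_h IH).
Qed.

Context (A B : choiceType) (stepA : A -> multidist R A -> Prop)
  (stepB : B -> multidist R B -> Prop) (g : A -> B).
Hypotheses (stepA_fdist : forall a mu, stepA a mu -> is_fdist mu)
  (stepB_fdist : forall b mu, stepB b mu -> is_fdist mu)
  (sim_g : simulation stepA stepB g).

Lemma value_simulation N a : value stepA N a <= value stepB N (g a).
Proof.
elim: N a => [|N IH] a //.
have [nfa|/contrapT[nu0 anu0]] := pselect (normal_form stepA a).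
  by rewrite value_nf // value_ge0.
apply: ge_sup => [|_ [nu anu <-]].
  by exists (1 + expect (value stepA N) nu0), nu0.
apply: le_trans (value_step stepB_fdist N (sim_g anu)).
by rewrite lerD2l expect_map_fdist le_expect //; exact: stepA_fdist anu.
Qed.

Lemma sup_edl_simulation mu : is_fdist mu ->
  (sup_edl stepA mu <= sup_edl stepB (map_fdist g mu))%E.
Proof.
move=> fmu; rewrite (sup_edl_value stepA_fdist fmu).
apply: ge_ereal_sup => _ [N _ <-].
apply: le_trans (expect_value_le_sup_edl stepB_fdist N (is_fdist_map g fmu)).
rewrite lee_fin expect_map_fdist; apply: le_expect => // a.
exact: value_simulation.
Qed.

End Simulation.

Section Loop.
Context {R : realType} {A : choiceType} (step : A -> multidist R A -> Prop).
Hypothesis step_fdist : forall a nu, step a nu -> is_fdist nu.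
Context (p : R) (u : nat -> A) (rest : nat -> multidist R A).
Hypotheses (p01 : 0 < p < 1) (u_step : forall k,
  step (u k) (mix_fdist p (dirac_fdist (u k.+1)) (rest k))).

(* Follows the loop from [u k] on; when it is left at stage [j], [S j] takes
   over. *)
Fixpoint loop_run (S : nat -> nat -> multidist R A) k m : multidist R A :=
  if m is m'.+1 then mix_fdist p (loop_run S k.+1 m') (S k m')
  else dirac_fdist (u k).

Section Edl.
Context (S : nat -> nat -> multidist R A).
Hypothesis runS : forall k, runs step (rest k) (S k).

Lemma runs_loop_run k : runs step (dirac_fdist (u k)) (loop_run S k).
Proof.
split=> // m; elim: m k => [|m IH] k /=.
  by rewrite (runS k).1; exact: lifting_step.
by apply: lifting_mix_fdist => //; exact: (runS k).2.
Qed.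

Lemma edl_loop_run_step k :
  (p%:E * edl step (loop_run S k.+1) + (1 - p)%:E * edl step (S k) <=
   edl step (loop_run S k))%E.
Proof.
rewrite (edl_behead step_fdist (runs_loop_run k)).
rewrite -(edl_mix_fdist step_fdist p01 (runs_loop_run k.+1) (runS k)) leeDr //.
by rewrite lee_fin; exact/expect_reducible_ge0/is_fdist_dirac.
Qed.

Lemma edl_loop_run_ge :
  (forall k, ((p ^- k)%:E <= (1 - p)%:E * edl step (S k))%E) ->
  forall m k, ((m%:R * p ^- k)%:E <= edl step (loop_run S k))%E.
Proof.
have /andP[p0 _] := p01; move=> S_ge; elim=> [|m IH] k.
  by rewrite mul0r (edl_ge0 step_fdist (runs_loop_run k)).
apply: le_trans (edl_loop_run_step k).
rewrite -natr1 mulrDl mul1r EFinD leeD //.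
rewrite (_ : m%:R * p ^- k = p * (m%:R * p ^- k.+1)).
  by rewrite EFinM lee_pmul2l // lte_fin.
by rewrite exprS invfM mulrCA mulVKf // gt_eqF.
Qed.

End Edl.

Lemma loop_not_PAST :
  (forall k, sup_edl step (rest k) = +oo%E) -> ~ PAST step.
Proof.
move=> rest_infty past; have /andP[p0 p1] := p01.
have /choice[S S_spec] k : exists S, runs step (rest k) S /\
    ((p ^- k)%:E <= (1 - p)%:E * edl step S)%E.
  have : ((p ^- k / (1 - p))%:E < sup_edl step (rest k))%E.
    by rewrite rest_infty ltry.
  move=> /ereal_sup_gt[_ [S runS <-] ltS]; exists S; split=> //.
  rewrite -(@divfK _ (1 - p) _ (p ^- k)) ?subr_eq0 ?gt_eqF // mulrC EFinM.
  by rewrite lee_pmul2l ?lte_fin ?subr_gt0 // ltW.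
have runS k := (S_spec k).1.
have := past _ _ (runs_loop_run runS 0%N); rewrite ltey => /eqP; apply.
apply/eqyP => r r0.
have := edl_loop_run_ge runS (fun k => (S_spec k).2) (Num.bound r) 0%N.
rewrite expr0 invr1 mulr1; apply: le_trans.
by rewrite lee_fin ltW // archi_boundP // ltW.
Qed.

End Loop.

Section Pumping.
Context {R : realType} {A : choiceType} (step : A -> multidist R A -> Prop).
Hypothesis step_fdist : forall a nu, step a nu -> is_fdist nu.

Lemma pumping_not_PAST (h g : A -> A) a mu p q b :
  simulation step step h -> simulation step step g ->
  step a mu -> ([mset (p, h a); (q, b)] `<=` mu)%mset ->
  (forall k, sup_edl step (dirac_fdist (g (iter k h b))) = +oo%E) ->
  ~ PAST step.
Proof.
move=> sim_h sim_g a_mu sub_mu b_infty; have fmu := step_fdist a_mu.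
have loop_mu := msubset_subset sub_mu (mset21 _ _).
have exit_mu : (q, b) \in (mu `\ (p, h a))%mset.
  have := msetSB [mset (p, h a)]%mset sub_mu.
  by rewrite msetD1K => /msubset_subset; apply; rewrite mset11.
have p_lt1 : p < 1 := fdist_weight_lt1 fmu loop_mu exit_mu.
have frem := is_fdist_rem fmu loop_mu p_lt1.
pose gh k := g \o iter k h.
have sim_gh k : simulation step step (gh k).
  exact: simulation_comp sim_g (simulation_iter k sim_h).
apply: (@loop_not_PAST _ _ step step_fdist p (fun k => gh k a)
  (fun k => map_fdist (gh k) (rem_fdist mu (p, h a)))) => [|k|k].
- by rewrite p_lt1 andbT; case/andP: (fmu.1 _ loop_mu).
- have -> : gh k.+1 a = gh k (h a) by rewrite /gh /= -iterSr.
  rewrite -map_fdist_dirac -map_fdist_mix -(mix_rem_fdist loop_mu p_lt1).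
  exact: sim_gh.
- have b_rem := mem_map_fdist (gh k) (mem_rem_fdist exit_mu).
  exact: (sup_edl_mem_infty step_fdist (is_fdist_map _ frem) b_rem (b_infty k)).
Qed.

End Pumping.

Section Rewriting.
Context {R : realType} {F : countType} {ar : F -> nat} {V : countType}.
Local Notation T := (term ar V).
Implicit Types (t u v : T) (C : context ar V) (tau sigma : substitution ar V).

Lemma subst_Var t : subst Var t = t.
Proof. by elim: t => //= f args IH; congr App; apply: funext. Qed.

Lemma subst_comp tau sigma t :
  subst tau (subst sigma t) = subst (subst tau \o sigma) t.
Proof. by elim: t => //= f args IH; congr App; apply: funext. Qed.

Lemma vars_subst sigma t x y :
  vars t x -> vars (sigma x) y -> vars (subst sigma t) y.
Proof.
by move=> + xy; elim: t => /= [z <-//|f args IH [i _ /IH iy]]; exists i.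
Qed.

Lemma vars_fill C t : vars t `<=` vars (fill C t).
Proof.
move=> y ty; elim: C => //= f i args C IH; exists i => //=.
by rewrite eqxx.
Qed.

Lemma subst_eq_fill tau t y : vars t y ->
  exists D, subst tau t = fill D (tau y).
Proof.
elim: t => /= [z ->|f args IH [i _ /IH[D DE]]]; first by exists Hole.
exists (CApp i (fun j => subst tau (args j)) D) => /=; congr App.
by apply: funext => j; case: eqP => // ->.
Qed.

Lemma subterm_at_subst tau t pi u : subterm_at t pi = Some u ->
  subterm_at (subst tau t) pi = Some (subst tau u).
Proof.
elim: pi t => [|i pi IH] t; first by move=> [<-].
by case: t => //= f args; case: insub => // j; exact: IH.
Qed.

Lemma replace_at_subst tau t pi u v : subterm_at t pi = Some u ->
  replace_at (subst tau t) pi (subst tau v) = subst tau (replace_at t pi v).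
Proof.
elim: pi t => [|i pi IH] [y|f args] //=.
case: insubP => // j _ ji sub_j; congr App; apply: funext => j'.
case: eqP => // j'i; apply: IH; rewrite (_ : j' = j) //.
by apply: val_inj; rewrite /= j'i.
Qed.

Variable P : set (T * multidist R T).

Lemma rewrite_step_rule t mu : P (t, mu) -> rewrite_step P t mu.
Proof.
move=> Pt; exists [::], t, mu, Var; split; rewrite ?subst_Var //.
rewrite -[LHS]map_fdist_id; congr map_fdist.
by apply: funext => r /=; rewrite subst_Var.
Qed.

Lemma rewrite_step_subst tau :
  simulation (rewrite_step P) (rewrite_step P) (subst tau).
Proof.
move=> t _ [pi [l [mu [sigma [Pl sub_t ->]]]]].
exists pi, l, mu, (subst tau \o sigma); split=> //.
  by rewrite (subterm_at_subst tau sub_t) subst_comp.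
rewrite -map_fdist_comp; congr map_fdist; apply: funext => r /=.
by rewrite -(replace_at_subst _ _ sub_t) subst_comp.
Qed.

Lemma rewrite_step_arg f (args : 'I_(ar f) -> T) i :
  simulation (rewrite_step P) (rewrite_step P)
    (fun t => App (fun j => if j == i then t else args j)).
Proof.
move=> t _ [pi [l [mu [sigma [Pl sub_t ->]]]]].
exists (val i :: pi), l, mu, sigma; split=> //; first by rewrite /= valK eqxx.
rewrite -map_fdist_comp; congr map_fdist; apply: funext => r /=.
by congr App; apply: funext => j; rewrite (inj_eq val_inj); case: eqP => // ->.
Qed.

Lemma rewrite_step_fill C :
  simulation (rewrite_step P) (rewrite_step P) (fill C).
Proof.
elim: C => [|f i args C IH]; first exact: simulation_id.
exact: simulation_comp (@rewrite_step_arg f args i) IH.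
Qed.

End Rewriting.

Theorem theorem3p22 (R : realType) (F V : countType) (ar : F -> nat)
    (P : set (term ar V * multidist R (term ar V)))
    (l : term ar V) (mu : multidist R (term ar V))
    (p1 p2 : R) (C : context ar V) (sigma : substitution ar V) (s : term ar V)
    (x : V) :
  is_ptrs P ->
  P (l, mu) ->
  ([mset (p1, fill C (subst sigma l)); (p2, s)] `<=` mu)%mset ->
  x \in vars l ->
  x \in vars (sigma x) `&` vars s ->
  PAST (rewrite_step P) <-> SAST (rewrite_step P).
Proof.
move=> ptrsP Pl sub_mu _ /set_mem[xsx xs].
have step_fdist t nu := @rewrite_step_fdist _ _ _ _ P t nu ptrsP.
split=> [past t|]; last exact: SAST_PAST.
rewrite ltey; apply/eqP => t_infty.
apply: (pumping_not_PAST (h := fill C \o subst sigma) (g := subst (fun=> t))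
  step_fdist _ _ (rewrite_step_rule Pl) sub_mu) past => [||k].
- exact: simulation_comp (rewrite_step_fill C) (rewrite_step_subst sigma).
- exact: rewrite_step_subst.
- have x_iter : vars (iter k (fill C \o subst sigma) s) x.
    by elim: k => //= k IH; apply: vars_fill; exact: vars_subst IH xsx.
  have [D ->] := subst_eq_fill (fun=> t) x_iter.
  apply/eqP; rewrite -leye_eq -t_infty -map_fdist_dirac.
  apply: sup_edl_simulation (is_fdist_dirac t) => //.
  exact: rewrite_step_fill.
Qed.
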